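(* Let $R$ be an associative ring with identity. If $R$ is left $F$-injective and strongly right finite dimensional, then $R$ is left finite dimensional.
   Context: For a module $M$, the Goldie dimension $\mathrm{G.dim}\, M$ equals $n$ if $M$ has an essential submodule that is a direct sum of $n$ uniform submodules; if no such integer $n$ exists, $\mathrm{G.dim}\, M=+\infty$. (A nonzero module is uniform if every nonzero submodule of it is essential.) The strongly Goldie dimension of $M$ is $\mathrm{SG.dim}\, M=\sup\{\mathrm{G.dim}(M/N) \mid N\le M\}$, which is $+\infty$ if this supremum is not finite. A ring $R$ is left finite dimensional if $\mathrm{G.dim}({}_RR)<+\infty$, and strongly right finite dimensional if $\mathrm{SG.dim}(R_R)<+\infty$. A ring $R$ is left $F$-injective if every left $R$-homomorphism from a finitely generated left ideal of $R$ to ${}_RR$ extends to a left $R$-homomorphism ${}_RR\to {}_RR$. *)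

(* Defs.v *)
From HB Require Import structures.
From mathcomp Require Import all_boot all_order all_algebra.
From mathcomp Require Import boolp classical_sets constructive_ereal.

Set Implicit Arguments.
Unset Strict Implicit.
Unset Printing Implicit Defensive.

Import Order.TTheory GRing.Theory Num.Theory.

Local Open Scope ring_scope.
Local Open Scope classical_set_scope.
Local Open Scope quotient_scope.

(* Modules are left modules (lmodType); right R-modules are left modules over
   the converse ring R^c.  The ring R may be zero (pzRingType).
   A submodule of M is a term of type submodClosed M.  Its membership
   predicate is boolean, which by classical logic is no restriction. *)

Section Submodule.
Variables (R : pzRingType) (M : lmodType R).

Definition submod (N : submodClosed M) : Type := {x : M | x \in N}.

HB.instance Definition _ (N : submodClosed M) := SubChoice.on (submod N).
HB.instance Definition _ (N : submodClosed M) :=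
  [SubChoice_isSubLmodule of submod N by <:].

Definition submod_nonzero (N : submodClosed M) : Prop :=
  exists2 x, x \in N & x != 0.

Definition essential (N : submodClosed M) : Prop :=
  forall K : submodClosed M, submod_nonzero K ->
    exists x, [/\ x \in N, x \in K & x != 0].

Definition finitely_generated (N : submodClosed M) : Prop :=
  exists (n : nat) (s : 'I_n -> M),
    forall x, x \in N <-> exists a : 'I_n -> R, x = \sum_i a i *: s i.

(* N is the internal direct sum of the submodules U i *)
Definition is_direct_sum (n : nat) (U : 'I_n -> submodClosed M)
    (N : submodClosed M) : Prop :=
  (forall x, x \in N <->
     exists2 u : 'I_n -> M, (forall i, u i \in U i) & x = \sum_i u i) /\
  (forall u : 'I_n -> M, (forall i, u i \in U i) ->
     \sum_i u i = 0 -> forall i, u i = 0).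

End Submodule.

Section QuotientModule.
Variables (R : pzRingType) (M : lmodType R) (N : submodClosed M).

Lemma submod_oppr_closed : oppr_closed (N : {pred M}).
Proof. by move=> x xN; rewrite -scaleN1r rpredZ. Qed.

Definition submod_zmodClosed : zmodClosed M :=
  HB.pack_for (zmodClosed M) (GRing.SubmodClosed.sort N)
    (GRing.isOppClosed.Build M (GRing.SubmodClosed.sort N) submod_oppr_closed).

Definition quotmod : Type := Quotient.quot submod_zmodClosed.
HB.instance Definition _ := GRing.Zmodule.on quotmod.
HB.instance Definition _ : EqQuotient M (Quotient.equiv submod_zmodClosed)
  quotmod := EqQuotient.on quotmod.
HB.instance Definition _ : ZmodQuotient M (Quotient.equiv submod_zmodClosed)
  0 -%R +%R quotmod := ZmodQuotient.on quotmod.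

Definition quot_scale (a : R) : quotmod -> quotmod :=
  lift_op1 quotmod ( *:%R a).

Lemma eq_quotmod x y : (x == y %[mod quotmod]) = (x - y \in N).
Proof. exact/esym/(Quotient.idealrBE submod_zmodClosed). Qed.

Lemma pi_quot_scale a x :
  quot_scale a (\pi_quotmod x) = \pi_quotmod (a *: x).
Proof.
rewrite /quot_scale; unlock; apply/eqP; rewrite eq_quotmod -scalerBr rpredZ //.
by rewrite -eq_quotmod reprK.
Qed.

Lemma pi_quotmodD x y :
  \pi_quotmod (x + y) = \pi_quotmod x + \pi_quotmod y.
Proof. by rewrite raddfD. Qed.

Lemma quot_scaleA a b u : quot_scale a (quot_scale b u) = quot_scale (a * b) u.
Proof. by elim/quotW: u => x; rewrite !pi_quot_scale scalerA. Qed.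

Lemma quot_scale1 : left_id 1 quot_scale.
Proof. by elim/quotW=> x; rewrite pi_quot_scale scale1r. Qed.

Lemma quot_scaleDr : right_distributive quot_scale +%R.
Proof.
move=> a; elim/quotW=> x; elim/quotW=> y.
by rewrite -pi_quotmodD !pi_quot_scale scalerDr pi_quotmodD.
Qed.

Lemma quot_scaleDl u : {morph quot_scale^~ u : a b / a + b}.
Proof.
by move=> a b; elim/quotW: u => x; rewrite !pi_quot_scale scalerDl pi_quotmodD.
Qed.

HB.instance Definition _ := GRing.Zmodule_isLmodule.Build R quotmod
  quot_scaleA quot_scale1 quot_scaleDr quot_scaleDl.

End QuotientModule.

Section GoldieDimension.
Variable R : pzRingType.

Definition uniform (M : lmodType R) : Prop :=
  (exists x : M, x != 0) /\
  forall N : submodClosed M, submod_nonzero N -> essential N.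

Definition has_Gdim (M : lmodType R) (n : nat) : Prop :=
  exists (U : 'I_n -> submodClosed M) (N : submodClosed M),
    [/\ forall i, uniform (submod (U i)), is_direct_sum U N & essential N].

(* Dimensions live in the integers extended with -oo and +oo, where every set
   of integers has a supremum. *)
Definition Gdim (M : lmodType R) : \bar int :=
  xget +oo%E [set d | exists2 n, has_Gdim M n & d = (n%:Z)%:E].

Definition SGdim (M : lmodType R) : \bar int :=
  supremum -oo%E (range (fun N : submodClosed M => Gdim (quotmod N))).

End GoldieDimension.

Definition left_finite_dimensional (R : pzRingType) : Prop :=
  (Gdim (R^o : lmodType R) < +oo)%E.

Definition strongly_right_finite_dimensional (R : pzRingType) : Prop :=
  (SGdim ((R^c)^o : lmodType R^c) < +oo)%E.

Definition left_F_injective (R : pzRingType) : Prop :=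
  forall I : submodClosed (R^o : lmodType R), finitely_generated I ->
  forall f : {linear submod I -> R^o},
    exists g : {linear R^o -> R^o}, forall x : submod I, g (val x) = f x.

(* Main.v *)
(* If R c_1 + ... + R c_m is a direct sum of nonzero left ideals, F-injectivity
   extends its projections to right multiplications by elements e_1, ..., e_m
   with c_j e_i = c_i when i = j and 0 otherwise.  Let N be the right ideal of
   the x with c_j x = 0 for all j.  The classes of the e_i in R / N are then
   nonzero and generate a direct sum of right modules, so m is bounded by
   the strong right Goldie dimension. *)
Require Import Defs.
From HB Require Import structures.
From mathcomp Require Import all_boot all_algebra.
From mathcomp Require Import order boolp classical_sets constructive_ereal.

Set Implicit Arguments.
Unset Strict Implicit.
Unset Printing Implicit Defensive.

Import Order.TTheory GRing.Theory Num.Theory.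

Local Open Scope ring_scope.
Local Open Scope quotient_scope.

(** * Submodules from predicates; uniformity in terms of elements *)

Section Submodules.
Variables (R : pzRingType) (M : lmodType R).

(** Stated as a sigma type, so that [sval] can define families of submodules. *)
Lemma submod_comprehension (P : M -> Prop) : P 0 ->
  (forall a x y, P x -> P y -> P (a *: x + y)) ->
  {N : submodClosed M | forall x, x \in N <-> P x}.
Proof.
move=> P0 PD; pose S : {pred M} := fun x => `[< P x >].
have S_closed : GRing.submod_closed S.
  split=> [|a x y]; first exact/asboolP.
  by move=> /asboolP Px /asboolP Py; apply/asboolP/PD.
exists (HB.pack_for (submodClosed M) S
         (GRing.isSubmodClosed.Build R M S S_closed)).
by move=> x; split=> /asboolP.
Qed.

Lemma span_submod n (P : pred 'I_n) (c : 'I_n -> M) :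
  {N : submodClosed M |
    forall x, x \in N <-> exists a, x = \sum_(i | P i) a i *: c i}.
Proof.
apply: submod_comprehension => [|b x y [a ->] [a' ->]].
  by exists (fun=> 0); rewrite big1 // => i _; rewrite scale0r.
exists (fun i => b * a i + a' i); rewrite scaler_sumr -big_split /=.
by apply: eq_bigr => i _; rewrite scalerDl scalerA.
Qed.

Lemma line_submod (x : M) :
  {N : submodClosed M | forall y, y \in N <-> exists a, y = a *: x}.
Proof.
apply: submod_comprehension => [|b y z [a ->] [a' ->]].
  by exists 0; rewrite scale0r.
by exists (b * a + a'); rewrite scalerDl scalerA.
Qed.

End Submodules.

(** Nonzero submodules meet as soon as nonzero cyclic ones do, so uniformity amounts to common
    nonzero multiples, without reference to submodules of [submod U]. *)
Lemma uniform_submodP (R : pzRingType) (M : lmodType R) (U : submodClosed M) :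
  uniform (submod U) <->
  submod_nonzero U /\
  forall x y, x \in U -> y \in U -> x != 0 -> y != 0 ->
    exists a b, a *: x = b *: y /\ a *: x != 0.
Proof.
split=> [[[x x0] unifU]|[[x xU x0] unifU]].
  split=> [|{x0}x0 y xU yU nzx nzy].
    by exists (val x) => //; exact: valP.
  have [N NP] := line_submod (Sub x0 xU : submod U).
  have [K KP] := line_submod (Sub y yU : submod U).
  have nzN : submod_nonzero N.
    by exists (Sub x0 xU); [apply/NP; exists 1; rewrite scale1r|].
  have nzK : submod_nonzero K.
    by exists (Sub y yU); [apply/KP; exists 1; rewrite scale1r|].
  have [z [/NP[a za] /KP[b zb] nzz]] := unifU N nzN K nzK.
  exists a, b; have /(congr1 val) /= := zb; rewrite {1}za /= => ->; split=> //.
  by move: nzz; rewrite zb.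
split=> [|N [y yN nzy] K [z zK nzz]]; first by exists (Sub x xU).
have [a [b [ab nza]]] := unifU (val y) (val z) (valP y) (valP z) nzy nzz.
exists (a *: y); split; [exact: rpredZ| |exact: nza].
suff -> : a *: y = b *: z by exact: rpredZ.
exact/val_inj.
Qed.

(** * Independent families and Goldie dimension *)

Section Independence.
Variables (R : pzRingType) (M : lmodType R).

(** The cyclic submodules of the [c i] are nonzero and form a direct sum. The terms [a i *: c i]
    must vanish, not the coefficients, since the [c i] may have nonzero annihilators. *)
Definition independent n (c : 'I_n -> M) :=
  (forall i, c i != 0) /\
  forall a : 'I_n -> R, \sum_i a i *: c i = 0 -> forall i, a i *: c i = 0.

Definition replace n (c : 'I_n -> M) (j : 'I_n) (u : M) (i : 'I_n) : M :=
  if i == j then u else c i.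

Lemma sum_replace n (c : 'I_n -> M) j u (a : 'I_n -> R) :
  \sum_i a i *: replace c j u i = a j *: u + \sum_(i | i != j) a i *: c i.
Proof.
rewrite (bigD1 j) //= /replace eqxx; congr (_ + _).
by apply: eq_bigr => i /negPf->.
Qed.

(** Moving [b *: c j] across gives a vanishing combination of the whole family, with coefficient
    [- b] at [j]. *)
Lemma independent_others n (c : 'I_n -> M) j b (a : 'I_n -> R) :
  independent c -> b *: c j = \sum_(i | i != j) a i *: c i -> b *: c j = 0.
Proof.
move=> [_ indc] ba; apply/eqP; rewrite -oppr_eq0 -scaleNr.
have := indc (fun i => if i == j then - b else a i) _ j.
rewrite /= eqxx => -> //; rewrite (bigD1 j) //= eqxx scaleNr ba.
rewrite addrC; apply/eqP; rewrite subr_eq0; apply/eqP/eq_bigr => i.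
by move/negPf->.
Qed.

Lemma independent_replace n (c : 'I_n -> M) j u :
  independent c -> u != 0 ->
  (forall b a, b *: u = \sum_(i | i != j) a i *: c i -> b *: u = 0) ->
  independent (replace c j u).
Proof.
move=> [nzc indc] nzu indu; split=> [i|a].
  by rewrite /replace; case: ifP => _; rewrite ?nzc.
rewrite sum_replace => a0.
have au0 : a j *: u = 0.
  apply: (indu _ (fun i => - a i)); apply/eqP.
  under eq_bigr do rewrite scaleNr.
  by rewrite sumrN -addr_eq0; apply/eqP.
move: a0; rewrite au0 add0r => a0 i.
rewrite /replace; case: eqP => [->//|/eqP ij].
have := indc (fun i => if i == j then 0 else a i) _ i.
rewrite /= (negPf ij) => -> //.
rewrite (bigD1 j) //= eqxx scale0r add0r -[RHS]a0.
by apply: eq_bigr => k /negPf->.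
Qed.

Definition adjoin n (c : 'I_n -> M) (u : M) (i : 'I_n.+1) : M :=
  oapp c u (unlift ord0 i).

Lemma independent_adjoin n (c : 'I_n -> M) u :
  independent c -> u != 0 ->
  (forall b a, b *: u = \sum_i a i *: c i -> b *: u = 0) ->
  independent (adjoin c u).
Proof.
move=> [nzc indc] nzu indu; split=> [i|a].
  by rewrite /adjoin; case: unliftP => //= k _; exact: nzc.
rewrite big_ord_recl /adjoin unlift_none /=.
under eq_bigr do rewrite liftK /=.
move=> a0.
have au0 : a ord0 *: u = 0.
  apply: (indu _ (fun i => - a (lift ord0 i))); apply/eqP.
  under eq_bigr do rewrite scaleNr.
  by rewrite sumrN -addr_eq0; apply/eqP.
move: a0; rewrite au0 add0r => /indc a0 i.
by case: unliftP => [k ->|->] /=; rewrite ?au0 ?a0.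
Qed.

(* Each step multiplies [x] so that one more component falls into [W] without
   vanishing. *)
Lemma essential_of_components n (U : 'I_n -> submodClosed M)
    (N W : submodClosed M) :
  (forall i, uniform (submod (U i))) -> is_direct_sum U N -> essential N ->
  (forall i, exists x, [/\ x \in W, x \in U i & x != 0]) -> essential W.
Proof.
move=> unifU [NP dirU] essN WU K /essN [x [/NP [u uU ->]]].
have [m] := ubnP #|[pred i | u i \notin W]|.
elim: m => // m IHm in u uU * => lem uK nzu.
have [/existsP[i uiW]|] := boolP [exists i, u i \notin W]; last first.
  move=> /existsPn uW; exists (\sum_i u i); split=> //.
  by apply: rpred_sum => i _; apply: contraT => /(negP (uW i)).
have nzui : u i != 0 by apply: contraNneq uiW => ->; rewrite rpred0.
have [w [wW wU nzw]] := WU i.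
have /uniform_submodP [_ /(_ _ _ (uU i) wU nzui nzw)[a [b [ab nza]]]] := unifU i.
apply: (IHm (fun j => a *: u j)).
- by move=> j; rewrite rpredZ.
- rewrite -ltnS (leq_trans _ lem) // ltnS; apply: proper_card.
  apply/properP; split; last first.
    by exists i; rewrite !inE // negbK ab rpredZ.
  by apply/fintype.subsetP => j; rewrite !inE; apply: contra => /rpredZ->.
- by rewrite -scaler_sumr rpredZ.
(* If the new sum vanished, directness would make its component [a *: u i] vanish. *)
- apply: contraNneq nza => /dirU -> // j; exact: rpredZ.
Qed.

(* Steinitz exchange: the members of an independent family are replaced one
   after the other by elements of the uniform summands. *)
Lemma has_Gdim_independent n m (c : 'I_m -> M) :
  has_Gdim M n -> independent c -> (m <= n)%N.
Proof.
move=> [U [N [unifU dirU essN]]] indc.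
have exch k : (k <= m)%N -> exists d : 'I_m -> M,
    independent d /\ forall i : 'I_m, (i < k)%N -> exists l, d i \in U l.
  elim: k => [_|k IHk km]; first by exists c.
  have [d [indd dU]] := IHk (ltnW km).
  pose j := Ordinal km.
  have [W WP] := span_submod (fun i => i != j) d.
  (* Either some [U i] meets [W] only in 0, and any nonzero element of it can replace [d j]; or [W]
     meets every [U i], so it is essential and meets the line of [d j], against independence. *)
  have [[i Wi]|/forallNP nWi] :=
    EM (exists i, forall x, x \in W -> x \in U i -> x = 0); last first.
    suff essW : essential W.
      have [L LP] := line_submod (d j).
      have [|x [/WP[a xa] /LP[b xb]]] := essW L.
        by exists (d j); [apply/LP; exists 1; rewrite scale1r|exact: indd.1].
      by rewrite xb (independent_others (a := a) indd) ?eqxx // -xb.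
    apply: essential_of_components unifU dirU essN _ => i.
    apply: contrapT => nex; apply: (nWi i) => x xW xU.
    by apply: contrapT => /eqP nzx; apply: nex; exists x.
  have /uniform_submodP [[u uU nzu] _] := unifU i.
  exists (replace d j u); split.
    apply: independent_replace => // b a bu.
    by apply: Wi; [apply/WP; exists a|exact: rpredZ].
  move=> l; rewrite /replace; case: eqP => [_ _|/eqP lj]; first by exists i.
  rewrite ltnS leq_eqVlt => /predU1P [lk|/dU //].
  by case/eqP: lj; apply: val_inj.
have [d [[nzd indd] dUex]] := exch m (leqnn m).
have /choice[f dU] := fun i => dUex i (ltn_ord i).
(* Two members in the same uniform summand would have a common nonzero multiple, against
   independence. *)
suff /leq_card : injective f by rewrite !card_ord.
move=> i j fij; apply: contrapT => /eqP ij; have ji : j != i by rewrite eq_sym.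
have /uniform_submodP [_ unifUi] := unifU (f i).
have [| |||a [b [ab nza]]] := unifUi (d i) (d j); rewrite ?nzd ?dU //.
  by rewrite fij dU.
move/eqP: nza; apply.
have := indd (fun l => if l == i then a else if l == j then - b else 0) _ i.
rewrite /= eqxx; apply.
rewrite (bigD1 i) //= eqxx (bigD1 j) //= (negPf ji) eqxx.
rewrite big1 => [|l /andP[/negPf-> /negPf->]]; last by rewrite scale0r.
by rewrite addr0 ab scaleNr subrr.
Qed.

(* An independent family of maximal length generates uniform submodules, and
   their sum is essential. *)
Lemma bounded_has_Gdim n :
  (forall m (c : 'I_m -> M), independent c -> (m <= n)%N) ->
  exists k, has_Gdim M k.
Proof.
move=> bnd; pose P m := `[< exists c : 'I_m -> M, independent c >].
have exP : exists m, P m.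
  exists 0%N; apply/asboolP; exists (fun=> 0).
  by split=> [[]|? ? []].
have bndP m : P m -> (m <= n)%N by move=> /asboolP[c /bnd].
case: (ex_maxnP exP bndP) => k /asboolP[c indc] maxk; exists k.
have noext (d : 'I_k.+1 -> M) : ~ independent d.
  move=> indd; suff : P k.+1 by move=> /maxk; rewrite ltnn.
  by apply/asboolP; exists d.
pose U i := sval (line_submod (c i)).
have UP i x : x \in U i <-> exists a, x = a *: c i.
  by exact: (svalP (line_submod (c i))).
have [N NP] := span_submod predT c.
exists U, N; split.
- move=> i; apply/uniform_submodP; split.
    by exists (c i); [apply/UP; exists 1; rewrite scale1r|exact: indc.1].
  move=> x y /UP[r ->] /UP[s ->] nzx nzy.
  (* Otherwise replacing [c i] by [r *: c i] and adjoining [s *: c i] would give an independent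
     family of length [k.+1]. *)
  apply: contrapT => nab.
  apply: (noext (adjoin (replace c i (r *: c i)) (s *: c i))).
  apply: independent_adjoin => //.
    apply: independent_replace => // b a; rewrite scalerA.
    exact: independent_others.
  move=> b a; rewrite sum_replace => ba.
  have ba' : b *: (s *: c i) = a i *: (r *: c i).
    apply/eqP; rewrite -subr_eq0 !scalerA -scalerBl; apply/eqP.
    apply: (independent_others (a := a) indc).
    by rewrite scalerBl -!scalerA ba addrC addKr.
  apply: contrapT => /eqP nzb; apply: nab; exists (a i), b.
  by rewrite -ba'.
- split=> [x|u uU u0 i].
    split=> [/NP[a ->]|[u uU ->]].
      exists (fun i => a i *: c i) => // i; apply/UP; by exists (a i).
    apply/NP; have /choice [a ua] := fun i => (UP i (u i)).1 (uU i).
    by exists a; apply: eq_bigr => i _.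
  have /choice [a ua] := fun i => (UP i (u i)).1 (uU i).
  by rewrite ua; apply: indc.2; rewrite -[RHS]u0; apply: eq_bigr.
(* If [K] met [N] only in 0, then [x] could be adjoined to [c]. *)
- move=> K [x xK nzx]; apply: contrapT => nex.
  apply: (noext (adjoin c x)); apply: independent_adjoin => // b a ba.
  apply: contrapT => /eqP nzb; apply: nex; exists (b *: x); split=> //.
    by apply/NP; exists a.
  exact: rpredZ.
Qed.

(** * Goldie dimensions as extended integers *)

Lemma Gdim_spec : (forall n, ~ has_Gdim M n) /\ Gdim M = +oo%E \/
  exists2 n, has_Gdim M n & Gdim M = (n%:Z)%:E.
Proof.
rewrite /Gdim; case: xgetP => [d _ [n Mn ->]|nM]; first by right; exists n.
by left; split=> // n Mn; apply: (nM n%:Z%:E); exists n.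
Qed.

Lemma Gdim_ge0 : (0 <= Gdim M)%E.
Proof. by case: Gdim_spec => [[_ ->]|[n _ ->]]; rewrite ?lee_fin. Qed.

End Independence.

(** Without a natural bound the only upper bound is [+oo]: a nonnegative member rules out [-oo].
    Nonemptiness also avoids the default value of [supremum]. *)
Lemma supremum_lty (A : set (\bar int)) :
  A !=set0%classic -> (forall d, A d -> 0 <= d)%E ->
  (supremum -oo A < +oo)%E -> exists n : nat, forall d, A d -> (d <= n%:Z%:E)%E.
Proof.
move=> [e Ae] A0; apply: contraPP => /forallNP unbd.
suff supA : supremums A +oo%E.
  rewrite /supremum; case: eqP => [A_0|_]; first by rewrite A_0 in Ae.
  by rewrite (xget_subset1 _ supA) //; exact: is_subset1_supremums.
split=> [d _|y yub]; first exact: leey.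
case: y => [z| |] in yub *; last 2 first.
- exact: lexx.
- by have := le_trans (A0 _ Ae) (yub _ Ae).
case: (unbd `|z|%N) => d /yub /le_trans; apply.
by rewrite lee_fin abszE ler_norm.
Qed.

Lemma pi_quotmod_eq0 (R : pzRingType) (M : lmodType R) (N : submodClosed M) x :
  (\pi_(quotmod N) x == 0) = (x \in N).
Proof. by rewrite -[x in RHS]subr0 -eq_quotmod raddf0. Qed.

Lemma pi_quotmodZ (R : pzRingType) (M : lmodType R) (N : submodClosed M) a x :
  a *: \pi_(quotmod N) x = \pi_(quotmod N) (a *: x).
Proof. exact: pi_quot_scale. Qed.

(** The dimension of each quotient is at most the supremum, and by exchange it bounds the
    independent families there. *)
Lemma SGdim_lty (R : pzRingType) (M : lmodType R) : (SGdim M < +oo)%E ->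
  exists n, forall (N : submodClosed M) m (c : 'I_m -> quotmod N),
    independent c -> (m <= n)%N.
Proof.
move=> /supremum_lty [||n bnd].
- have [N _] := line_submod (0 : M); by exists (Gdim (quotmod N)), N.
- by move=> _ [N _ <-]; exact: Gdim_ge0.
exists n => N m c indc.
have /bnd : range (fun N : submodClosed M => Gdim (quotmod N))
    (Gdim (quotmod N)).
  by exists N.
case: (Gdim_spec (quotmod N)) => [[_ ->]//|[k Nk ->]].
rewrite lee_fin lez_nat; apply: leq_trans; exact: has_Gdim_independent Nk indc.
Qed.

(** * Projections obtained from F-injectivity *)

Lemma F_injective_projectors (R : pzRingType) m (c : 'I_m -> R^o) :
  left_F_injective R -> independent c ->
  exists e : 'I_m -> R, forall i j, c j * e i = if j == i then c i else 0.
Proof.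
move=> Finj indc.
suff /choice[e ce] :
    forall i, exists e : R, forall j, c j * e = if j == i then c i else 0.
  by exists e.
move=> i; have [I IP] := span_submod predT c.
have fgI : finitely_generated I by exists m, c.
have /choice [a aP] := fun x : submod I => (IP (val x)).1 (valP x).
(* The coefficients [a x i] are arbitrary choices, but independence makes the component
   [a x i *: c i] depend only on [x], hence linearly. *)
have f_lin : GRing.linear_for *:%R (fun x : submod I => a x i *: c i : R^o).
  move=> r x y; apply/eqP; rewrite -subr_eq0; apply/eqP.
  rewrite scalerA -scalerDl -scalerBl.
  apply: (indc.2 (fun i => a (r *: x + y) i - (r * a x i + a y i))).
  under eq_bigr do rewrite scalerBl scalerDl -scalerA.
  by rewrite sumrB big_split /= -scaler_sumr -!aP /= subrr.
pose f : {linear submod I -> R^o} := HB.pack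
  (fun x : submod I => a x i *: c i : R^o)
  (GRing.isLinear.Build _ _ _ _ _ f_lin).
have [g gf] := Finj I fgI f.
(* A left linear endomorphism of [R^o] is right multiplication by its value at 1. *)
exists (g 1) => j.
have cjI : c j \in I.
  apply/IP; exists (fun l => if l == j then 1 else 0).
  rewrite (bigD1 j) //= eqxx scale1r big1 ?addr0 // => l /negPf->.
  by rewrite scale0r.
have -> : c j * g 1 = f (Sub (c j) cjI : submod I).
  rewrite -gf /= -[LHS]/(c j *: g 1) -linearZ; congr (g _); exact: mulr1.
rewrite /f /=.
(* The chosen coefficients [b] of [c j] may differ from 1 at [j] and 0 elsewhere; independence makes
   the terms at [i] agree. *)
have := aP (Sub (c j) cjI); set b := a _ => /= cjb.
have : (b i - (if j == i then 1 else 0)) *: c i = 0.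
  rewrite eq_sym; apply: (indc.2 (fun i => b i - (if i == j then 1 else 0))).
  under eq_bigr do rewrite scalerBl.
  rewrite sumrB -cjb (bigD1 j) //= eqxx scale1r big1 ?addr0 ?subrr //.
  move=> l /negPf->.
  by rewrite scale0r.
rewrite scalerBl => /eqP; rewrite subr_eq0 => /eqP->.
by case: ifP; rewrite ?scale1r ?scale0r.
Qed.

Theorem theorem3p2 (R : pzRingType) :
  left_F_injective R -> strongly_right_finite_dimensional R ->
  left_finite_dimensional R.
Proof.
move=> Finj /SGdim_lty [n bnd].
have [k Rk] : exists k, has_Gdim (R^o : lmodType R) k.
  apply: (@bounded_has_Gdim _ _ n) => m c indc.
  have [e ce] := F_injective_projectors Finj indc.
  have [|b x y xN yN i|N NP] :=
    @submod_comprehension _ ((R^c)^o : lmodType R^c)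
      (fun x : R => forall i, c i * x = 0).
  - by move=> i; rewrite mulr0.
  (* Scalars of [R^c] act by right multiplication in [R]. *)
  - by rewrite mulrDr yN addr0 -[b *: x]/((x : R) * b) mulrA xN mul0r.
  apply: (bnd N m (fun i => \pi_(quotmod N) (e i))); split=> [i|a].
    rewrite pi_quotmod_eq0; apply/negP => /NP /(_ i).
    rewrite ce eqxx; apply/eqP; exact: indc.1.
  under eq_bigr do rewrite pi_quotmodZ.
  (* The sum of the [e l * a l] lies in [N]. Multiplying it by [c j] on the left leaves [c j * a j],
     which is therefore 0, and this puts [e j * a j] in [N]. *)
  rewrite -raddf_sum => /eqP; rewrite pi_quotmod_eq0 => /NP ea0 i.
  apply/eqP; rewrite pi_quotmodZ pi_quotmod_eq0; apply/NP => j.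
  have cea l :
      c j * (a l *: (e l : (R^c)^o)) = if j == l then c l * a l else 0.
    by rewrite -[_ *: _]/(e l * a l) mulrA ce; case: ifP; rewrite ?mul0r.
  rewrite cea; case: eqP => // <-; rewrite -[RHS](ea0 j) mulr_sumr.
  rewrite (bigD1 j) //= cea eqxx big1 ?addr0 // => l /negPf jl.
  by rewrite cea eq_sym jl.
rewrite /left_finite_dimensional.
case: (Gdim_spec (R^o : lmodType R)) => [[nR _]|[l _ ->]].
  by case: (nR k).
exact: ltry.
Qed.
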